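(* Let $q \ge 2$ and $1 \le k \le n$ be integers, let $d$ be an integer with $0 < d \le 2k$, and let $l = k - d/2$. Let $\mathcal{F}$ be an $(n,k,l)_q$-family. If $$|\mathcal{F}| > \max\{\,2l+2,\; 4(k-l)^2 + 2(k-l) + 1,\; q-1\,\},$$ then $l$ is an integer, $\mathcal{F}$ is a $\Delta_q(n,k,l)$-system, and $$|\mathcal{F}| \le \frac{n-l}{k-l}.$$
   Context: $H_q^n = \{0,1,\ldots,q-1\}^n$ is the $q$-ary Hamming space; $x(i)$ denotes the $i$-th coordinate of $x$, $\mathrm{supp}(x) = \{i \in [n] : x(i) \neq 0\}$ with $[n]=\{1,\ldots,n\}$, $\mathrm{wt}(x) = |\mathrm{supp}(x)|$, and $\mathrm{d_H}(x,y) = |\{i \in [n]: x(i) \neq y(i)\}|$. The Johnson space is $J_q^{n,k} = \{x \in H_q^n : \mathrm{wt}(x) = k\}$. For $x,y \in J_q^{n,k}$ the intersection size is defined as $|x \cap y|_q = k - \mathrm{d_H}(x,y)/2$ (possibly a half-integer). An $(n,k,l)_q$-family, with $l = k - d/2$, is an equidistant code $\mathcal{F} \subseteq J_q^{n,k}$ with distance $d$, i.e. $\mathrm{d_H}(x,y) = d$ for all distinct $x,y \in \mathcal{F}$ (equivalently, $|x\cap y|_q = l$ for all distinct $x,y\in\mathcal{F}$). A code $C \subseteq J_q^{n,k}$ is a $\Delta_q(n,k,l)$-system if there is a set $D \subseteq [n]$ (the kernel) with $|D| = l$ such that (1) for any two distinct codewords $x,y \in C$, $x(i) = y(i) \neq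 0$ for all $i \in D$; and (2) the sets $\mathrm{supp}(x) \setminus D$, $x \in C$, are pairwise disjoint. *)

(* Defs.v *)
From HB Require Import structures.
From mathcomp Require Import all_boot all_order all_algebra.

Set Implicit Arguments.
Unset Strict Implicit.
Unset Printing Implicit Defensive.

Import Order.TTheory GRing.Theory Num.Theory.
Local Open Scope ring_scope.

(* Coordinates are indexed from 0, by 'I_n; the alphabet is 'I_q, with no
   algebraic structure, so being a nonzero symbol is tested on the underlying
   natural number. *)
Notation hamming q n := {ffun 'I_n -> 'I_q}.

Definition supp (q n : nat) (x : hamming q n) : {set 'I_n} :=
  [set i | (x i != 0 :> nat)%N].

Definition wt (q n : nat) (x : hamming q n) : nat := #|supp x|.

Definition dH (q n : nat) (x y : hamming q n) : nat :=
  #|[set i | x i != y i]|.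

Definition johnson (q n k : nat) : {set hamming q n} :=
  [set x | wt x == k].

Definition equidistant (q n d : nat) (F : {set hamming q n}) : Prop :=
  {in F &, forall x y : hamming q n, x != y -> dH x y = d}.

(* The (n,k,l)_q-families. The intersection size l is rational since it may be
   a half-integer; it determines the distance d. *)
Definition nkl_family (q n k : nat) (l : rat) (F : {set hamming q n}) : Prop :=
  F \subset johnson q n k /\
  exists2 d : nat, l = k%:R - d%:R / 2 & equidistant d F.

(* The Delta_q(n,k,l)-systems, with kernel D. *)
Definition Delta_system (q n k : nat) (l : rat) (C : {set hamming q n}) : Prop :=
  C \subset johnson q n k /\
  exists D : {set 'I_n},
    [/\ #|D|%:R = l,
        {in C &, forall x y : hamming q n, x != y ->
           {in D, forall i, x i = y i /\ (x i != 0 :> nat)%N}} &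
        {in C &, forall x y : hamming q n, x != y ->
           [disjoint supp x :\: D & supp y :\: D]}].

(* Main.v *)
(* Encode a word x as the set of the pairs (i, x i) and (i, 0) for i in its
   support. These are 2k-sets, and since the encodings of two symbols always
   differ in exactly 0 or 2 elements, any two of them meet in 2l elements.
   Deza's theorem makes them a sunflower. If (i, 0) lies in the kernel, then the
   i-th letters are nonzero, and they are all equal because q - 1 nonzero
   letters are too few for |F| distinct ones; if it does not, at most one word
   is nonzero at i.

   For Deza's theorem, let M sets of size lam + m meet pairwise in lam points.
   A Gram matrix estimate shows that each point is contained in at most m + 1
   sets or missed by at most m + 1 sets. Complementing the columns beta of the
   second kind keeps the pairwise distances 2m and makes all degrees at most
   m + 1; counting then leaves disjoint m-sets, or the lines of a projective
   plane of order m with one more set. In the first case these m-sets all meet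
   beta in equally many points, and if not in none, then |beta| is so large that
   M <= lam + 2; the second case contradicts uniformity. *)
Require Import Defs.
From HB Require Import structures.
From mathcomp Require Import all_boot all_order all_algebra.
From mathcomp Require Import zify ring lra.

Set Implicit Arguments.
Unset Strict Implicit.
Unset Printing Implicit Defensive.

Import Order.TTheory GRing.Theory Num.Theory.
Local Open Scope ring_scope.

(** * Counting incidences between sets and points *)

Lemma card_sum_mem (T : finType) (A : {set T}) : #|A| = (\sum_x (x \in A))%N.
Proof. by rewrite -sum1_card big_mkcond. Qed.

(** The quadratic form of the Gram matrix of the indicator vectors, as a sum of squares over the
    points. Semirings are allowed so that it serves both integer and natural weights. *)
Lemma sum_sqr_incidence (R : comNzSemiRingType) (I T : finType)
    (f : I -> {set T}) (F : {set I}) (c : I -> R) :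
  \sum_x (\sum_(i in F) c i * (x \in f i)%:R) ^+ 2
  = \sum_(i in F) \sum_(j in F) c i * c j * #|f i :&: f j|%:R.
Proof.
under eq_bigr do rewrite expr2 big_distrlr.
rewrite exchange_big; apply: eq_bigr => i _.
rewrite exchange_big; apply: eq_bigr => j _.
rewrite card_sum_mem natr_sum mulr_sumr; apply: eq_bigr => x _ /=.
by rewrite mulrACA -natrM mulnb in_setI.
Qed.

Lemma sum_card_disjoint (I T : finType) (f : I -> {set T}) (F : {set I})
    (U : {set T}) :
    {in F, forall i, f i \subset U} ->
    {in F &, forall i j, i != j -> [disjoint f i & f j]} ->
  (\sum_(i in F) #|f i| <= #|U|)%N.
Proof.
move=> sub dis.
under eq_bigr do rewrite card_sum_mem.
rewrite exchange_big [leqRHS]card_sum_mem; apply: leq_sum => x _.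
have [/existsP[i /andP[iF xi]]|/existsPn no] :=
  boolP [exists i, (i \in F) && (x \in f i)].
  rewrite (subsetP (sub i iF) _ xi) (bigD1 i iF) /= xi big1 // => j /andP[jF ji].
  by rewrite (disjointFl (dis _ _ jF iF ji) xi).
by rewrite big1 // => i iF; have := no i; rewrite iF /= => /negbTE->.
Qed.

(** * Point degrees in equidistant families of sets *)

(** The Gram matrix is [m I + lam J], and the weights [c] are proportional to its inverse applied to
    the indicator of the sets through [x]. The square at [x] alone is at most the whole quadratic
    form, and a factor [r * (m + lam * s)] cancels. *)
Lemma degree_bound (I T : finType) (f : I -> {set T}) (F : {set I}) (m lam : nat)
    (x : T) (r := #|[set i in F | x \in f i]|) (s := #|[set i in F | x \notin f i]|) :
    (0 < m)%N -> {in F, forall i, #|f i| = (lam + m)%N} ->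
    {in F &, forall i j, i != j -> #|f i :&: f j| = lam} ->
  (r * (m + lam * s) <= m * (m + lam * (r + s)))%N.
Proof.
move=> m0 unif inter.
have [->//|r0] := posnP r.
pose c i : int := if x \in f i then (m + lam * s)%N%:Z else - (lam * r)%N%:Z.
have split_sum (a b : int) :
    \sum_(i in F) (if x \in f i then a else b) = r%:Z * a + s%:Z * b.
  rewrite (bigID (fun i => x \in f i)) /=; congr (_ + _).
    rewrite (eq_bigr (fun=> a)) => [|i /andP[_ ->]//].
    by rewrite -big_set /= sumr_const -mulr_natl natz.
  rewrite (eq_bigr (fun=> b)) => [|i /andP[_ /negbTE->]//].
  by rewrite -big_set /= sumr_const -mulr_natl natz.
have gram := sum_sqr_incidence f F c.
have sumc : \sum_(i in F) c i = (r * m)%N%:Z by rewrite split_sum; lia.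
have sumc2 : \sum_(i in F) c i ^+ 2
    = r%:Z * (m + lam * s)%N%:Z ^+ 2 + s%:Z * (lam * r)%N%:Z ^+ 2.
  rewrite -split_sum; apply: eq_bigr => i _; rewrite /c.
  by case: ifP => // _; rewrite sqrrN.
have rhsE : \sum_(i in F) \sum_(j in F) c i * c j * #|f i :&: f j|%:R
    = lam%:Z * (\sum_(i in F) c i) ^+ 2 + m%:Z * \sum_(i in F) c i ^+ 2.
  rewrite expr2 big_distrlr !mulr_sumr -big_split; apply: eq_bigr => i iF /=.
  rewrite (bigD1 i iF) [in RHS](bigD1 i iF) /= setIid unif // mulrDr mulr_sumr.
  rewrite addrAC natrD !natz.
  congr (_ + _); first by ring.
  apply: eq_bigr => j /andP[jF ji].
  rewrite (inter i j iF jF); last by rewrite eq_sym.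
  by rewrite natz mulrC.
have colx : (r%:Z * (m + lam * s)%N%:Z) ^+ 2
    <= \sum_x (\sum_(i in F) c i * (x \in f i)%:R) ^+ 2.
  rewrite (bigD1 x) //= -[leLHS]addr0 lerD ?sumr_ge0// => [|y _]; last exact: sqr_ge0.
  suff -> : \sum_(i in F) c i * (x \in f i)%:R = r%:Z * (m + lam * s)%N%:Z by [].
  have := split_sum (m + lam * s)%N%:Z 0; rewrite mulr0 addr0 => <-.
  by apply: eq_bigr => i _; rewrite /c; case: ifP; rewrite ?mulr1 ?mulr0.
move: colx; rewrite gram rhsE sumc sumc2 => key.
rewrite -(@leq_pmul2l (r * (m + lam * s))); last by rewrite muln_gt0 r0 addn_gt0 m0.
rewrite -lez_nat; apply: le_trans (le_trans _ key) _; rewrite ?lez_nat; lia.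
Qed.

Lemma sum_degree (I T : finType) (f : I -> {set T}) (F : {set I}) (U : {set T}) :
  (\sum_(x in U) \sum_(i in F) (x \in f i) = \sum_(i in F) #|U :&: f i|)%N.
Proof.
rewrite exchange_big; apply: eq_bigr => i _.
rewrite card_sum_mem big_mkcond; apply: eq_bigr => x _ /=.
by rewrite in_setI; case: (x \in U).
Qed.

(** The sum of the squared degrees is at most [c * S]; it also equals the sum of all
    [#|f i :&: f j|], which the sizes and the distance [2 * m] determine. Sizes may vary, since
    complementing columns destroys uniformity. *)
Lemma equidistant_sum_card (I T : finType) (f : I -> {set T}) (F : {set I})
    (m c : nat) (S := (\sum_(i in F) #|f i|)%N) :
    {in F &, forall i j, i != j -> (#|f i| + #|f j| = 2 * m + 2 * #|f i :&: f j|)%N} ->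
    (forall x, (\sum_(i in F) (x \in f i) <= c)%N) ->
  (#|F| * S + m * #|F| <= c * S + m * #|F| * #|F|)%N.
Proof.
move=> dist deg.
have sq : (\sum_x (\sum_(i in F) (x \in f i)) ^ 2
           = \sum_(i in F) \sum_(j in F) #|f i :&: f j|)%N.
  transitivity (\sum_x (\sum_(i in F) (1 : nat) * (x \in f i)%:R) ^+ 2).
    apply: eq_bigr => x _; congr (_ ^ 2)%N; apply: eq_bigr => i _.
    by rewrite mul1r natn.
  rewrite (sum_sqr_incidence f F (fun=> 1 : nat)).
  apply: eq_bigr => i _; apply: eq_bigr => j _.
  by rewrite !mul1r natn.
have sq_le : (\sum_x (\sum_(i in F) (x \in f i)) ^ 2 <= c * S)%N.
  have -> : S = (\sum_x \sum_(i in F) (x \in f i))%N.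
    by rewrite exchange_big; apply: eq_bigr => i _; rewrite card_sum_mem.
  rewrite big_distrr leq_sum // => x _.
  by rewrite -mulnn leq_mul2r deg orbT.
have pairs : (2 * (\sum_(i in F) \sum_(j in F) #|f i :&: f j|) + 2 * m * #|F| * #|F|
            = 2 * #|F| * S + 2 * m * #|F|)%N.
  have row i : i \in F -> (2 * (\sum_(j in F) #|f i :&: f j|) + #|F| * (2 * m)
            = #|F| * #|f i| + S + 2 * m)%N.
    have cst b : (#|F| * b = \sum_(j in F) b)%N by rewrite sum_nat_const.
    move=> iF; rewrite /S !cst big_distrr -!big_split.
    rewrite (bigD1 i) //= [in RHS](bigD1 i) //= setIid.
    have -> : (\sum_(j in F | j != i) (2 * #|f i :&: f j| + 2 * m)
      = \sum_(j in F | j != i) (#|f i| + #|f j|))%N.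
      by apply: eq_bigr => j /andP[jF ji]; rewrite dist 1?eq_sym // addnC.
    by lia.
  have := eq_bigr (op := addn) (idx := 0%N) (r := index_enum I) _ row.
  rewrite !big_split /= -!big_distrr /= !sum_nat_const.
  by rewrite -/S; lia.
by nia.
Qed.

(** The second moment bound puts the average size below [m + 1]. One set smaller than [m] makes all
    the others large, which leaves only the second alternative. Otherwise most sets have size [m]
    and are pairwise disjoint, and a larger set would have to meet all of these. *)
Lemma equidistant_small_degree (I T : finType) (f : I -> {set T}) (F : {set I})
    (m : nat) :
    (0 < m)%N -> (m * m + m + 1 < #|F|)%N ->
    {in F &, forall i j, i != j -> (#|f i| + #|f j| = 2 * m + 2 * #|f i :&: f j|)%N} ->
    (forall x, (\sum_(i in F) (x \in f i) <= m + 1)%N) ->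
    (m = 1%N -> forall x, (\sum_(i in F) (x \in f i) <= 1)%N) ->
  {in F, forall i, #|f i| = m} \/
  (#|F| = m * m + m + 2)%N /\
  exists2 i0, i0 \in F &
    (#|f i0| + 1 = m)%N /\ {in F, forall i, i != i0 -> #|f i| = (m + 1)%N}.
Proof.
move=> m0 Fbig dist deg deg1.
pose S := (\sum_(i in F) #|f i|)%N.
have hS := equidistant_sum_card dist deg; rewrite -/S in hS.
have S_lt : (S < (m + 1) * #|F|)%N.
  rewrite ltnNge; apply/negP => hS'.
  have [a aE a_gt] : exists2 a, #|F| = (a + (m + 1))%N & (m * m < a)%N.
    by exists (#|F| - (m + 1))%N; lia.
  have aS : (a * ((m + 1) * #|F|) <= a * S)%N by rewrite leq_mul2l hS' orbT.
  have : ((a * (m + 1) + m) * #|F| <= m * (a + (m + 1)) * #|F|)%N.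
    by rewrite aE in hS aS *; lia.
  by rewrite leq_pmul2r; lia.
have [/existsP[i0 /andP[i0F lt_i0]]|/existsPn ge_m] :=
  boolP [exists i, (i \in F) && (#|f i| < m)%N]; [right|left].
  have cardF : #|F| = #|F :\ i0|.+1 by rewrite (cardsD1 i0) i0F.
  have lower b : {in F :\ i0, forall i, (b <= #|f i|)%N} ->
      (#|f i0| + b * (#|F| - 1) + \sum_(i in F :\ i0) (#|f i| - b) = S)%N.
    move=> hb; rewrite /S [in RHS](bigD1 i0) //= -addnA; congr (_ + _)%N.
    have -> : (b * (#|F| - 1) = \sum_(i in F :\ i0) b)%N.
      by rewrite sum_nat_const cardF subn1 mulnC.
    rewrite -big_split; apply: eq_big => [i|i iF /=]; first by rewrite !inE andbC.
    by rewrite subnKC ?hb.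
  have dist0 : {in F :\ i0, forall i,
      (#|f i0| + #|f i| = 2 * m + 2 * #|f i0 :&: f i|)%N}.
    by move=> i; rewrite !inE => /andP[ii0 iF]; rewrite dist // eq_sym.
  (* A size of at most [m - 2] would force all other sizes to be at least [m + 2], making [S] too
     large. *)
  have wi0 : (#|f i0| + 1 = m)%N.
    apply/eqP/contraT => ne.
    have bd : {in F :\ i0, forall i, (2 * m - #|f i0| <= #|f i|)%N}.
      by move=> i /dist0; lia.
    move: (lower _ bd); move: (\sum_(i in _) _)%N => e.
    have -> : (2 * m - #|f i0| = m + (m - #|f i0|))%N by lia.
    have : (2 <= m - #|f i0|)%N by lia.
    by move: (m - #|f i0|)%N (subnKC (ltnW lt_i0)) => a; nia.
  have {}lower := lower (m + 1)%N.
  have ge1 : {in F :\ i0, forall i, (m + 1 <= #|f i|)%N}.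
    by move=> i /dist0; lia.
  have {}lower := lower ge1.
  (* The excess over [m + 1] is even by [dist0], and the excesses sum to less than 2 by [S_lt]. *)
  have others : {in F, forall i, i != i0 -> #|f i| = (m + 1)%N}.
    move=> i iF ii0; have iF' : i \in F :\ i0 by rewrite !inE ii0.
    have := dist0 i iF'; have := ge1 i iF'.
    move: lower; rewrite (bigD1 i) //=.
    move: (\sum_(i in _ | _) _)%N => e; move: (#|_ :&: _|)%N => t.
    move: (#|f i|)%N => w; nia.
  split; last by exists i0.
  have {}lower : (#|f i0| + (m + 1) * (#|F| - 1) = S)%N.
    rewrite -lower big1 ?addn0 // => i; rewrite !inE => /andP[ii0 iF].
    by rewrite others ?subnn.
  by nia.
have ge i : i \in F -> (m <= #|f i|)%N.
  by move=> iF; have := ge_m i; rewrite iF -leqNgt.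
pose Tm := [set i in F | #|f i| == m].
have TmF : Tm \subset F by apply/subsetP => i; rewrite inE => /andP[].
have [i1 /andP[i1F /eqP wi1]] : exists i, (i \in F) && (#|f i| == m).
  apply/existsP/contraT => /existsPn no.
  have : ((m + 1) * #|F| <= S)%N.
    rewrite mulnC -sum_nat_const leq_sum // => i iF.
    by have := no i; have := ge i iF; rewrite iF /=; lia.
  by lia.
(* All sizes have the parity of [m], so those other than [m] are at least [m + 2]. With [S_lt], more
   than half of the sets are in [Tm]. *)
have S_ge : (m * #|F| + 2 * (#|F| - #|Tm|) <= S)%N.
  rewrite -(cardsDS TmF) mulnC -sum_nat_const mulnC -sum_nat_const.
  rewrite /S [leqRHS](bigID (mem Tm)) /= [(\sum_(i in F) m)%N](bigID (mem Tm)) /=.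
  rewrite -addnA leq_add //.
    by apply: leq_sum => i /andP[iF _]; exact: ge.
  have -> : (\sum_(i in F :\: Tm) 2 = \sum_(i in F | i \notin Tm) 2)%N.
    by apply: eq_bigl => i; rewrite inE andbC.
  rewrite -big_split /= leq_sum // => i /andP[iF]; rewrite inE iF /= => wi.
  have := dist i i1 iF i1F; rewrite wi1; have := ge i iF.
  case: eqVneq => [ii1|_ _ /(_ isT)]; last by lia.
  by rewrite ii1 wi1 eqxx in wi.
move=> j jF; apply/eqP/contraT => wj.
have jTm : j \notin Tm by rewrite inE jF.
have ltTm : (#|Tm| < #|F|)%N.
  by apply: proper_card; apply/properP; split=> //; exists j.
have Tm2 i : i \in Tm -> i \in F /\ #|f i| = m by rewrite inE => /andP[iF /eqP].
have meet_j i : i \in Tm -> (2 * #|f i :&: f j| + m = #|f j|)%N.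
  move=> iTm; have [iF wi] := Tm2 i iTm.
  have := dist i j iF jF; rewrite wi; case: eqVneq => [ij|_ /(_ isT)]; last by lia.
  by rewrite -ij iTm in jTm.
have i1Tm : i1 \in Tm by rewrite inE i1F wi1 eqxx.
have := ge j jF; have := meet_j i1 i1Tm; set e := #|f i1 :&: f j| => he hge.
(* The members of [Tm] are disjoint and each meets [f j] in [e > 0] points; since
   [#|f j| = m + 2 * e], this gives [#|Tm| <= m + 2]. *)
have : (#|Tm| * e <= #|f j|)%N.
  rewrite -sum_nat_const; apply: leq_trans (_ : \sum_(i in Tm) #|f i :&: f j| <= _)%N.
    by apply: leq_sum => i /meet_j; lia.
  apply: sum_card_disjoint => [i _|i i' iT i'T ii']; first exact: subsetIr.
  have [[iF wi] [i'F wi']] := (Tm2 _ iT, Tm2 _ i'T).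
  have := dist i i' iF i'F ii'; rewrite wi wi' => h.
  have /eqP : #|f i :&: f i'| = 0%N by lia.
  rewrite cards_eq0 setI_eq0; apply: disjointW; exact: subsetIl.
(* The two estimates of [#|Tm|] conflict only for [m >= 2]. For [m = 1], degrees at most 1 give
   [S <= #|F|], against [S_ge]. *)
have [m1|m1] := eqVneq m 1%N.
  have := equidistant_sum_card dist (deg1 m1); rewrite -/S m1 in S_ge *.
  by nia.
by nia.
Qed.

(** If [r > m], the estimate yields [r * s < m * (r + s)], that is [(r - m) * (s - m) < m * m],
    whatever [lam] is. A product this small with a sum [r + s] this large forces one factor to be at
    most 1. *)
Lemma degree_gap (m lam r s : nat) :
    (0 < m)%N -> (m * m + m + 1 < r + s)%N ->
    (r * (m + lam * s) <= m * (m + lam * (r + s)))%N ->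
  ((r <= m + 1) || (s <= m + 1))%N && ((m == 1) ==> (r <= 1) || (s <= 1))%N.
Proof.
move=> m0 big le.
have [r_m|m_r] := leqP r m.
  by apply/andP; split; [|apply/implyP => /eqP m1]; apply/orP; left; lia.
have lt : (r * s < m * (r + s))%N.
  rewrite ltnNge; apply/negP => ge.
  have : (lam * (m * (r + s)) <= lam * (r * s))%N by rewrite leq_mul2l ge orbT.
  have : (m * m < r * m)%N by rewrite ltn_pmul2r.
  by lia.
apply/andP; split; last first.
  apply/implyP => /eqP m1; apply/contraT; rewrite negb_or -!ltnNge => /andP[].
  by rewrite m1 in big lt; case: r lt {le m_r} big => [|[|r]]; case: s => [|[|s]] //; nia.
apply/contraT; rewrite negb_or -!ltnNge => /andP[r1 s1].
have [a ra] : exists a, r = (m + 2 + a)%N by exists (r - (m + 2))%N; lia.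
have [b sb] : exists b, s = (m + 2 + b)%N by exists (s - (m + 2))%N; lia.
subst r s.
have : (2 * (a + b) + 4 < m * m)%N by nia.
have : (m * m < a + b + m + 3)%N by lia.
by case: m m0 {r1 s1 le m_r lt big} => [|[|m]] // _; nia.
Qed.

(** * Deza's theorem *)

(** The bound [lam + 2] cannot be lowered: for [m = 1] and [lam >= 2], the subsets of size [lam + 1]
    of a set of [lam + 2] points satisfy the other hypotheses and form no sunflower. *)
Lemma deza_sunflower (I T : finType) (f : I -> {set T}) (F : {set I})
    (m lam : nat) :
    (0 < m)%N -> {in F, forall i, #|f i| = (lam + m)%N} ->
    {in F &, forall i j, i != j -> #|f i :&: f j| = lam} ->
    (m * m + m + 1 < #|F|)%N -> (lam + 2 < #|F|)%N ->
  exists D, {in F &, forall i j, i != j -> f i :&: f j = D}.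
Proof.
move=> m0 unif inter Fbig Flam.
pose beta := [set x | m + 1 < \sum_(i in F) (x \in f i)]%N.
pose g i := [set x | (x \in f i) (+) (x \in beta)].
have gE i x : (x \in g i) = (x \in f i) (+) (x \in beta) by rewrite inE.
have degE x : (\sum_(i in F) (x \in f i) = #|[set i in F | x \in f i]|)%N.
  by rewrite -sum1dep_card big_mkcondr.
have degN x : (\sum_(i in F) (x \notin f i) = #|[set i in F | x \notin f i]|)%N.
  by rewrite -sum1dep_card big_mkcondr.
have deg_split x : (\sum_(i in F) (x \in f i) + \sum_(i in F) (x \notin f i) = #|F|)%N.
  by rewrite -big_split -sum1_card; apply: eq_bigr => i _ /=; case: (x \in f i).
have gap x : (((\sum_(i in F) (x \in f i) <= m + 1)
      || (\sum_(i in F) (x \notin f i) <= m + 1))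
    && ((m == 1) ==> (\sum_(i in F) (x \in f i) <= 1)
      || (\sum_(i in F) (x \notin f i) <= 1)))%N.
  have := degree_bound x m0 unif inter; rewrite -degE -degN => /degree_gap.
  by apply=> //; rewrite deg_split.
have deg_g x : (\sum_(i in F) (x \in g i) =
    if x \in beta then \sum_(i in F) (x \notin f i) else \sum_(i in F) (x \in f i))%N.
  by case: ifP => xb; apply: eq_bigr => i _; rewrite gE xb ?addbT ?addbF.
have deg x : (\sum_(i in F) (x \in g i) <= m + 1)%N.
  rewrite deg_g; have /andP[] := gap x; case: ifP; rewrite inE; last by lia.
  by lia.
(* Off [beta] the degree is at most 2; if moreover at most one set missed [x], then [#|F| <= 3],
   against [Fbig]. *)
have deg1 : m = 1%N -> forall x, (\sum_(i in F) (x \in g i) <= 1)%N.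
  move=> m1 x; rewrite deg_g; have /andP[_] := gap x; have := deg_split x.
  by case: ifP; rewrite inE; lia.
have dist : {in F &, forall i j, i != j ->
    (#|g i| + #|g j| = 2 * m + 2 * #|g i :&: g j|)%N}.
  move=> i j iF jF ij.
  have : (#|g i| + #|g j| + 2 * #|f i :&: f j|
          = #|f i| + #|f j| + 2 * #|g i :&: g j|)%N.
    rewrite !card_sum_mem !big_distrr -!big_split; apply: eq_bigr => x _ /=.
    by rewrite !in_setI !gE; case: (x \in f i) (x \in f j) (x \in beta) => [] [] [].
  by rewrite !unif // inter //; lia.
(* Uniformity of the original sets, read through [g]: [f i] is the symmetric difference of [g i] and
   [beta]. *)
have wtE i : i \in F -> (lam + m + 2 * #|beta :&: g i| = #|g i| + #|beta|)%N.
  move=> iF; rewrite -(unif i iF).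
  rewrite !card_sum_mem !big_distrr -!big_split; apply: eq_bigr => x _ /=.
  by rewrite !in_setI !gE; case: (x \in f i) (x \in beta) => [] [].
have [wm|[Fm [i0 i0F [wi0 wi]]]] := equidistant_small_degree m0 Fbig dist deg deg1.
  have dis : {in F &, forall i j, i != j -> [disjoint g i & g j]}.
    move=> i j iF jF ij; rewrite -setI_eq0 -cards_eq0.
    by have := dist i j iF jF ij; rewrite !wm //; lia.
  have : (\sum_(i in F) #|beta :&: g i| <= #|beta|)%N.
    apply: sum_card_disjoint => [i _|i j iF jF ij]; first exact: subsetIl.
    by apply: disjointW (dis i j iF jF ij); exact: subsetIr.
  have half i : i \in F -> (2 * #|beta :&: g i| + lam = #|beta|)%N.
    by move=> iF; have := wtE i iF; rewrite wm //; lia.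
  have [i1 i1F] : exists i, i \in F by apply/card_gt0P; lia.
  have e1 := half i1 i1F; set e := #|beta :&: g i1| in e1.
  rewrite (eq_bigr (fun=> e)) => [|i /half]; last by lia.
  rewrite sum_nat_const => le.
  (* Here [#|F| * e <= 2 * e + lam], so [e > 0] would give [#|F| <= lam + 2]. *)
  have e0 : e = 0%N by nia.
  have beta_sub i : i \in F -> beta \subset f i.
    move=> iF; apply/subsetP => x xb; apply/contraT => xi.
    have : x \in beta :&: g i by rewrite in_setI xb gE xb addbT.
    by rewrite (_ : _ :&: _ = set0) ?inE //; apply/eqP; rewrite -cards_eq0; have := half i iF; lia.
  exists beta => i j iF jF ij; apply/esym/eqP.
  by rewrite eqEcard subsetI !beta_sub //= inter //; lia.
exfalso.
(* The lines of a projective plane of order [m] together with [g i0], disjoint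
   from them all; every line then meets [beta] in the same number [e] of
   points, with [0 < e <= m], and counting incidences gives
   [m + 1 %| e * (m * m + m + 1)]. *)
have i0_lines i : i \in F -> i != i0 -> #|g i0 :&: g i| = 0%N.
  by move=> iF ii0; have := dist i0 i i0F iF; rewrite eq_sym => /(_ ii0); rewrite (wi i) //; lia.
have deg_line i x : i \in F -> i != i0 -> x \in g i ->
    (\sum_(j in F) (x \in g j) = m + 1)%N.
  move=> iF ii0 xi; apply/eqP; rewrite eqn_leq deg leqNgt /=; apply/negP => lt.
  (* A line meets itself in [m + 1] points and each of the [m * m + m] other lines in one, so all
     its points must have the maximal degree. *)
  have meets : (\sum_(j in F) #|g i :&: g j| = (m + 1) * (m + 1))%N.
    rewrite (bigD1 i0) //= setIC i0_lines // (bigD1 i) /=; last by rewrite iF.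
    rewrite setIid (wi i) // (eq_bigr (fun=> 1%N)) => [|j /andP[/andP[jF ji0] ji]]; last first.
      by have := dist i j iF jF; rewrite eq_sym => /(_ ji); rewrite (wi i) // (wi j) //; lia.
    rewrite sum1_card.
    have -> : #|[pred j | (j \in F) && (j != i0) & j != i]| = (m * m + m)%N.
      have : #|F :\ i0 :\ i| = (m * m + m)%N.
        by have := cardsD1 i0 F; have := cardsD1 i (F :\ i0); rewrite !inE i0F iF ii0; lia.
      by move=> <-; apply: eq_card => j; rewrite !inE; case: (j \in F) (j == i0) (j == i) => [] [] [].
    by lia.
  have := sum_degree g F (g i); rewrite meets (bigD1 x) //=.
  have : (\sum_(y in g i | y != x) \sum_(j in F) (y \in g j) <= m * (m + 1))%N.
    have -> : (m * (m + 1) = \sum_(y in g i :\ x) (m + 1))%N.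
      by rewrite sum_nat_const; have := cardsD1 x (g i); rewrite xi (wi i) //; lia.
    rewrite (eq_bigl (mem (g i :\ x))) => [|y]; last by rewrite !inE andbC.
    by apply: leq_sum => y _; exact: deg.
  by lia.
(* The sizes of a line and of [g i0] differ by 2, so by [wtE] their intersections with [beta] differ
   by 1. *)
have [e eE] : exists e, {in F, forall i, i != i0 -> #|beta :&: g i| = e}.
  exists (#|beta :&: g i0| + 1)%N => i iF ii0.
  by have := wtE i iF; have := wtE i0 i0F; rewrite (wi i) //; lia.
have [i1 i1F i1i0] : exists2 i, i \in F & i != i0.
  have : (0 < #|F :\ i0|)%N by have := cardsD1 i0 F; rewrite i0F; lia.
  by case/card_gt0P => i; rewrite !inE => /andP[]; exists i.
have e_bd : (0 < e <= m)%N.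
  have := subset_leq_card (subsetIr beta (g i0)).
  by rewrite -(eE i1) //; have := wtE i1 i1F; have := wtE i0 i0F; rewrite (wi i1) //; lia.
have := sum_degree g (F :\ i0) beta.
rewrite [in RHS](eq_bigr (fun=> e)) => [|i /setD1P[ii0 iF]]; last exact: eE.
rewrite sum_nat_const.
have -> : #|F :\ i0| = (m * m + m + 1)%N by have := cardsD1 i0 F; rewrite i0F; lia.
move=> tot.
have : (m + 1 %| (m * m + m + 1) * e)%N.
  rewrite -tot; apply: dvdn_sum => x _.
  have [/existsP[i /andP[/andP[iF ii0] xi]]|/existsPn no] :=
    boolP [exists i, (i \in F) && (i != i0) && (x \in g i)].
    have := deg_line i x iF ii0 xi; rewrite (bigD1 i0) //=.
    have -> : x \in g i0 = false.
      apply/negbTE/negP => x0; have : x \in g i0 :&: g i by rewrite inE x0.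
      by rewrite (_ : _ :&: _ = set0) ?inE //; apply/eqP; rewrite -cards_eq0 i0_lines.
    rewrite add0n => <-; rewrite (eq_bigl (mem (F :\ i0))) => [|j]; last by rewrite !inE andbC.
    exact: dvdnn.
  rewrite big1 ?dvdn0 // => i /setD1P[ii0 iF].
  by have := no i; rewrite iF ii0 /= => /negbTE->.
(* Since [m * m + m + 1] is 1 modulo [m + 1], the divisibility passes to [e], which lies strictly
   between 0 and [m + 1]. *)
have -> : ((m * m + m + 1) * e = (m + 1) * (m * e) + e)%N by lia.
rewrite dvdn_addr ?dvdn_mulr // => /dvdn_leq; lia.
Qed.

(** * Encoding words as sets *)

Definition flags (q n : nat) (x : hamming q n) : {set 'I_n * 'I_q} :=
  [set p | (x p.1 != 0 :> nat)%N && ((p.2 == x p.1) || (p.2 == 0 :> nat)%N)].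

(** The identity holds at each coordinate: two nonzero letters share two pairs if equal and one if
    different, and a zero letter shares none. Taking [x = y] gives the size of [flags x]. *)
Lemma card_flagsI (q n : nat) (x y : hamming q n) : (0 < q)%N ->
  (2 * #|flags x :&: flags y| + 2 * dH x y = 2 * wt x + 2 * wt y)%N.
Proof.
move=> q0; pose z : 'I_q := Ordinal q0.
have sum_eq (a : 'I_q) : (\sum_(b < q) (b == a) = 1)%N.
  by rewrite -(card1 a) -sum1_card [RHS]big_mkcond.
have zE (a : 'I_q) : (a == 0 :> nat)%N = (a == z) by [].
rewrite /wt /dH !card_sum_mem.
have -> : (\sum_p (p \in flags x :&: flags y)
    = \sum_i \sum_b ((i, b) \in flags x :&: flags y))%N.
  by rewrite pair_bigA; apply: eq_bigr => -[].
rewrite !big_distrr -!big_split; apply: eq_bigr => i _ /=.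
have -> : (\sum_(b < q) ((i, b) \in flags x :&: flags y)
    = (x i != z) * (y i != z) * (1 + (x i == y i)))%N.
  rewrite -(sum_eq z) -[X in (_ + X)%N]muln1 -[X in (_ + _ * X)%N](sum_eq (x i)).
  rewrite big_distrr -big_split big_distrr; apply: eq_bigr => b _ /=.
  rewrite !inE /= !zE.
  have [->|bz] := eqVneq b z.
    rewrite !(eq_sym z) !orbT !andbT.
    by case: (x i == z); case: (y i == z); case: (x i == y i).
  rewrite !orbF; have [->|bx] := eqVneq b (x i); last by rewrite !andbF !muln0.
  by rewrite andbT; case: (x i == z); case: (y i == z); case: (x i == y i).
rewrite !inE !zE.
have [->|ne] := eqVneq (x i) (y i); first by case: eqP.
by have [xz|xz] := eqVneq (x i) z; have [yz|yz] := eqVneq (y i) z; rewrite // xz yz eqxx in ne.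
Qed.

(** * Kernels of equidistant codes *)

(** Two words agree on [D] and have disjoint supports outside it, so each support has [d / 2] points
    outside [D]. These remainders are disjoint in the complement of [D]; everything is doubled
    because [d] is not yet known to be even. *)
Lemma Delta_kernel_card (q n k d : nat) (F : {set hamming q n}) (D : {set 'I_n}) :
    F \subset johnson q n k -> equidistant d F -> (1 < #|F|)%N ->
    {in F &, forall x y : hamming q n, x != y ->
       {in D, forall i, x i = y i /\ (x i != 0 :> nat)%N}} ->
    {in F &, forall x y : hamming q n, x != y -> [disjoint supp x :\: D & supp y :\: D]} ->
  [/\ (2 * #|D| + d = 2 * k)%N &
      (#|F| * d + 2 * #|D| <= 2 * n)%N].
Proof.
move=> FJ Feq F2 agree dis.
have [x [y [xF yF xy]]] : exists x y, [/\ x \in F, y \in F & x != y].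
  by have /card_gt1P[x [y [xF yF xy]]] := F2; exists x, y.
have wtk z : z \in F -> wt z = k by move=> /(subsetP FJ); rewrite inE => /eqP.
have DE : (2 * #|D| + d = 2 * k)%N.
  rewrite mul2n -addnn -addnA -(Feq x y xF yF xy) mul2n -addnn.
  rewrite -{1}(wtk x xF) -(wtk y yF).
  rewrite /dH /wt !card_sum_mem -!big_split; apply: eq_bigr => i _ /=.
  have := agree x y xF yF xy i; have := disjointFr (dis x y xF yF xy) (x := i).
  rewrite !inE; case: (i \in D) => /=.
    by move=> _ [//|-> ->]; rewrite eqxx.
  move=> h _; case: (eqVneq (x i) (y i)) h => [->|ne].
    by case: eqP => //= _ /(_ isT).
  case: (eqVneq (x i : nat) 0%N) => [x0 _|_ ->//] /=.
  case: (eqVneq (y i : nat) 0%N) => // y0.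
  by case/eqP: ne; apply/val_inj; rewrite /= x0 y0.
split=> //.
(* [agree] speaks of distinct words only, so [z] is paired with [x], or with [y] when [z = x]. *)
have DsubF z : z \in F -> D \subset supp z.
  move=> zF; apply/subsetP => i iD; rewrite inE.
  have [zx|zx] := eqVneq z x; last by case: (agree z x zF xF zx i iD).
  by rewrite zx; case: (agree x y xF yF xy i iD).
have : (\sum_(z in F) #|supp z :\: D| <= #|~: D|)%N.
  by apply: sum_card_disjoint => // z _; rewrite setDE subsetIr.
rewrite (eq_bigr (fun=> (k - #|D|)%N)) => [|z zF]; last first.
  by rewrite cardsDS ?DsubF // -/(wt z) wtk.
rewrite sum_nat_const; have := cardsC D; rewrite card_ord; nia.
Qed.

Lemma equidistant_Delta_kernel (q n k d : nat) (F : {set hamming q n}) :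
    (0 < q)%N -> (0 < d)%N -> (d <= 2 * k)%N ->
    F \subset johnson q n k -> equidistant d F ->
    (d * d + d + 1 < #|F|)%N -> (2 * k - d + 2 < #|F|)%N -> (q <= #|F|)%N ->
  exists D : {set 'I_n},
    {in F &, forall x y : hamming q n, x != y ->
       {in D, forall i, x i = y i /\ (x i != 0 :> nat)%N}} /\
    {in F &, forall x y : hamming q n, x != y ->
       [disjoint supp x :\: D & supp y :\: D]}.
Proof.
move=> q0 d0 dk FJ Feq Fd Fk Fq; pose z : 'I_q := Ordinal q0.
have wtk x : x \in F -> wt x = k by move=> /(subsetP FJ); rewrite inE => /eqP.
have unif : {in F, forall x, #|flags x| = (2 * k - d + d)%N}.
  move=> x xF; have := card_flagsI x x q0; rewrite setIid wtk // /dH.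
  by rewrite (_ : [set _ | _] = set0) ?cards0; [lia|apply/setP => i; rewrite !inE eqxx].
have inter : {in F &, forall x y, x != y -> #|flags x :&: flags y| = (2 * k - d)%N}.
  by move=> x y xF yF xy; have := card_flagsI x y q0; rewrite !wtk // Feq //; lia.
(* Here [m = d] and [lam = 2 * k - d], twice the intersection size of the words. *)
have [D meetD] := deza_sunflower d0 unif inter Fd Fk.
have flagz x i : ((i, z) \in flags x) = (x i != z) by rewrite inE /= orbT andbT.
have flagI x i a : ((i, a) \in flags x) = (x i != z) && ((a == x i) || (a == z)).
  by rewrite inE.
have subD x i a : x \in F -> (i, a) \in D -> (i, a) \in flags x.
  move=> xF; have [y] : exists y, y \in F :\ x.
    by apply/card_gt0P; have := cardsD1 x F; rewrite xF; lia.
  by move=> /setD1P[yx yF]; rewrite -(meetD x y) 1?eq_sym // => /setIP[].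
exists [set i | (i, z) \in D]; split=> x y xF yF xy; last first.
  rewrite -setI_eq0 -subset0; apply/subsetP => i; rewrite !inE.
  move=> /andP[/andP[iD xi] /andP[_ yi]].
  case/negP: iD; rewrite -(meetD x y) // in_setI !flagz.
  by apply/andP.
move=> i; rewrite inE => iD.
have nz w : w \in F -> w i != z by move=> wF; rewrite -flagz subD.
split; last exact: nz.
apply/eqP/contraT => xyi.
(* If two words differ at [i], then all words do, and none is zero there. *)
have inj : {in F &, injective (fun w : hamming q n => w i)}.
  move=> u v uF vF /= uv; apply/eqP/contraT => neq.
  (* A nonzero letter common to two words puts its pair into the kernel, hence into the encoding of
     every word, so all words would agree at [i]. *)
  have iuD : (i, u i) \in D.
    by rewrite -(meetD u v) // in_setI !flagI -uv !nz // eqxx.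
  have same w : w \in F -> u i = w i.
    move=> wF; have := subD w _ _ wF iuD; rewrite flagI (negbTE (nz u uF)) orbF.
    by move=> /andP[_ /eqP].
  by rewrite -(same x xF) -(same y yF) eqxx in xyi.
have : (#|[set w i | w : hamming q n in F]| <= #|[set~ z]|)%N.
  by apply/subset_leq_card/subsetP => _ /imsetP[w wF ->]; rewrite !inE nz.
rewrite card_in_imset // cardsC1 card_ord => le_q; exfalso.
by have := leq_trans Fq le_q; lia.
Qed.

Theorem theorem10 (q n k d : nat) (l : rat) (F : {set hamming q n})
  (hq : (2 <= q)%N) (hk : (1 <= k)%N) (hkn : (k <= n)%N)
  (hd0 : (0 < d)%N) (hdk : (d <= 2 * k)%N)
  (hl : l = k%:R - d%:R / 2)
  (hF : nkl_family k l F)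
  (hcard : Num.max (Num.max (2 * l + 2)
                            (4 * (k%:R - l) ^+ 2 + 2 * (k%:R - l) + 1))
                   (q%:R - 1) < #|F|%:R) :
  [/\ l \is a Num.int,
      Delta_system k l F &
      #|F|%:R <= (n%:R - l) / (k%:R - l)].
Proof.
have [FJ [d' ld' Fd']] := hF.
(* The distance hidden in [nkl_family] is determined by [l]. *)
have dd' : d' = d by apply/eqP; rewrite -(eqr_nat rat); apply/eqP; move: hl; rewrite ld'; lra.
rewrite {}dd' {d' ld'} in Fd'.
move: hcard; rewrite !gt_max => /andP[/andP[hc1 hc2] hc3].
have Fk : (2 * k - d + 2 < #|F|)%N.
  rewrite -(ltr_nat rat) natrD natrB // natrM; move: hc1; rewrite hl; lra.
(* Since [k - l = d / 2], the quadratic term of the maximum is exactly [d * d + d + 1]. *)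
have Fd : (d * d + d + 1 < #|F|)%N.
  rewrite -(ltr_nat rat) !natrD natrM; move: hc2; rewrite hl.
  by rewrite (_ : k%:R - (k%:R - d%:R / 2) = d%:R / 2 :> rat); [nra|ring].
have Fq : (q <= #|F|)%N.
  by rewrite -ltnS -(ltr_nat rat) -natr1; move: hc3; lra.
have q0 : (0 < q)%N by lia.
have [D [agree dis]] := equidistant_Delta_kernel q0 hd0 hdk FJ Fd' Fd Fk Fq.
have F2 : (1 < #|F|)%N by lia.
have [Dd Dn] := Delta_kernel_card FJ Fd' F2 agree dis.
have lD : l = #|D|%:R.
  have := congr1 (fun a : nat => a%:R : rat) Dd; rewrite natrD !natrM hl; lra.
have kl : k%:R - l = d%:R / 2 by rewrite hl; ring.
split.
- by rewrite lD natr_int.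
- by split=> //; exists D.
rewrite kl ler_pdivlMr ?divr_gt0 ?ltr0n // lD.
move: Dn; rewrite -(ler_nat rat) natrD !natrM; lra.
Qed.
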